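(* Let $d\in\{2,3\}$, let $\rho>0$, $\mu>0$, $\nu\in(0,\tfrac12)$, $\omega>0$, and set $k_1=\omega/c_1$, $k_2=\omega/c_2$ with $$c_1=\sqrt{\frac{2\mu(1-\nu)}{\rho(1-2\nu)}},\qquad c_2=\sqrt{\frac{\mu}{\rho}}.$$ Let $\boldsymbol f\in[\mathcal P_N]^d$. Let $\boldsymbol q\in[\mathcal P_N]^d$ be the polynomial solution of $(\Delta+k_1^2)\boldsymbol q=\dfrac{\boldsymbol f}{2(1-\nu)}$ and let $\boldsymbol g\in[\mathcal P_N]^d$ be the polynomial solution of $(\Delta+k_2^2)\boldsymbol g=\boldsymbol q$ in $\mathbb R^d$ (both exist and are unique). Then $$\boldsymbol u=2(1-\nu)(\Delta+k_1^2)\boldsymbol g-\nabla(\operatorname{div}\boldsymbol g)\in[\mathcal P_N]^d$$ is the unique polynomial solution of the time-harmonic Navier equation $$\Delta\boldsymbol u+\frac{1}{1-2\nu}\nabla(\operatorname{div}\boldsymbol u)+k_2^2\boldsymbol u=\boldsymbol f\quad\text{in }\mathbb R^d.$$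
   Context: $\mathcal P_N$ denotes the space of all $d$-variate polynomials of total degree at most $N\in\mathbb N_0$. $\Delta$ acts componentwise on vector fields. Here $\rho$ is the mass density, $\mu$ the shear modulus, $\nu$ the Poisson's ratio, and $\omega$ the angular frequency. *)

(* Defs.v *)
From mathcomp Require Import all_boot all_order all_algebra.
From mathcomp.multinomials Require Import mpoly.

Set Implicit Arguments.
Unset Strict Implicit.
Unset Printing Implicit Defensive.

Import Order.TTheory GRing.Theory Num.Theory.
Local Open Scope ring_scope.

(* Vector fields on R^d with polynomial components. The coefficients lie in a
   field K, so that real (K = R) and complex amplitudes are both covered. *)
Definition polyfield (K : fieldType) (d : nat) := {ffun 'I_d -> {mpoly K[d]}}.

(* [P_N]^d; msize p is the total degree of p plus one, and msize 0 = 0. *)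
Definition in_PN (K : fieldType) (d N : nat) (u : polyfield K d) : Prop :=
  forall i : 'I_d, (msize (u i) <= N.+1)%N.

Definition grad (K : fieldType) (d : nat) (p : {mpoly K[d]}) : polyfield K d :=
  [ffun i => p^`M(i)].

Definition div (K : fieldType) (d : nat) (u : polyfield K d) : {mpoly K[d]} :=
  \sum_(i < d) (u i)^`M(i).

Definition laplacian (K : fieldType) (d : nat) (u : polyfield K d) :
    polyfield K d :=
  [ffun i => \sum_(j < d) (u i)^`M(j)^`M(j)].

Definition helmholtz (K : fieldType) (d : nat) (k : K) (u : polyfield K d) :
    polyfield K d :=
  laplacian u + k ^+ 2 *: u.

Definition navier (K : fieldType) (d : nat) (nu k2 : K) (u : polyfield K d) :
    polyfield K d :=
  laplacian u + (1 - 2 * nu)^-1 *: grad (div u) + k2 ^+ 2 *: u.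

(* u lies in [P_N]^d, solves L u = f, and is the only solution among polynomial
   fields of arbitrary degree. *)
Definition unique_poly_solution (K : fieldType) (d N : nat)
    (L : polyfield K d -> polyfield K d) (f u : polyfield K d) : Prop :=
  [/\ in_PN N u, L u = f & forall v : polyfield K d, L v = f -> v = u].

(* Main.v *)
Require Import Defs.
From HB Require Import structures.
From mathcomp Require Import all_boot all_order all_algebra.
From mathcomp.multinomials Require Import mpoly.
From mathcomp Require Import ring lra.

Set Implicit Arguments.
Unset Strict Implicit.
Unset Printing Implicit Defensive.

Import Order.TTheory GRing.Theory Num.Theory.
Local Open Scope ring_scope.

(** Two facts carry the proof.

    Differentiation lowers the degree, so on polynomials the Laplacian is
    nilpotent on each space of bounded degree, and a nonzero multiple of the
    identity dominates it.  Hence [a Delta + c] is injective for every nonzero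
    [c] ([lap_shift_inj]), and for nonzero [k] the operator [Delta + k^2] is
    bijective on the fields of degree at most [N]
    ([helmholtz_unique_solution]).

    All operators have constant coefficients, so they commute.  Write
    [H_k = Delta + k^2], [b = 2 (1 - nu)] and
    [u = b H_k1 g - grad (div g)].  The wave numbers satisfy
    [b k1^2 = (1 - 2 nu) k2^2], and [b - 1 = 1 - 2 nu], so that
    [div u = (b - 1) Delta (div g) + b k1^2 div g = (1 - 2 nu) div (H_k2 g)]
    ([div_potential]).  The term [(1 - 2 nu)^-1 grad (div u)] of the Navier
    operator is therefore [grad (div (H_k2 g))], which is exactly what the term
    [- grad (div g)] of [u] contributes to [H_k2 u] with the opposite sign.
    What remains is [b H_k1 (H_k2 g)] ([navier_potential]), and this is the
    right-hand side by the choice of [q] and [g].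

    For uniqueness, the divergence of a homogeneous Navier solution [v] solves
    a scalar equation [(a Delta + k2^2) (div v) = 0], so it vanishes; then
    [H_k2 v = 0], and [v] vanishes too ([navier_inj]). *)

(** * Linearity of the operators *)

(** Scalar counterpart of [laplacian], needed because taking the divergence
    turns the vector equations into scalar ones. *)
Definition lap (K : fieldType) (d : nat) (p : {mpoly K[d]}) : {mpoly K[d]} :=
  \sum_(j < d) p^`M(j)^`M(j).

Section Linearity.
Variables (K : fieldType) (d : nat).
Implicit Types (p : {mpoly K[d]}) (u : polyfield K d).

Lemma lap_is_linear : linear (@lap K d).
Proof.
move=> c p q; rewrite /lap scaler_sumr -big_split /=.
by apply: eq_bigr => j _; rewrite !linearP.
Qed.

HB.instance Definition _ :=
  GRing.isLinear.Build K {mpoly K[d]} {mpoly K[d]} _ (@lap K d) lap_is_linear.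

Lemma grad_is_linear : linear (@grad K d).
Proof. by move=> c p q; apply/ffunP => i; rewrite !ffunE linearP. Qed.

HB.instance Definition _ :=
  GRing.isLinear.Build K {mpoly K[d]} (polyfield K d) _ (@grad K d)
    grad_is_linear.

Lemma div_is_linear : linear (@div K d).
Proof.
move=> c u v; rewrite /div scaler_sumr -big_split /=.
by apply: eq_bigr => j _; rewrite !ffunE linearP.
Qed.

HB.instance Definition _ :=
  GRing.isLinear.Build K (polyfield K d) {mpoly K[d]} _ (@div K d)
    div_is_linear.

Lemma laplacianE u i : laplacian u i = lap (u i).
Proof. by rewrite ffunE. Qed.

Lemma helmholtzE k u i : helmholtz k u i = lap (u i) + k ^+ 2 *: u i.
Proof. by rewrite !ffunE. Qed.

Lemma laplacian_is_linear : linear (@laplacian K d).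
Proof.
by move=> c u v; apply/ffunP => i; rewrite !(laplacianE, ffunE) -linearP.
Qed.

HB.instance Definition _ :=
  GRing.isLinear.Build K (polyfield K d) (polyfield K d) _ (@laplacian K d)
    laplacian_is_linear.

Lemma helmholtz_is_linear k : linear (@helmholtz K d k).
Proof.
move=> c u v; rewrite /helmholtz linearP !scalerDr !scalerA [c * _]mulrC.
by rewrite addrACA.
Qed.

HB.instance Definition _ k :=
  GRing.isLinear.Build K (polyfield K d) (polyfield K d) _ (@helmholtz K d k)
    (helmholtz_is_linear k).

Lemma navierE nu k u :
  navier nu k u = helmholtz k u + (1 - 2 * nu)^-1 *: grad (div u).
Proof. by rewrite /navier addrAC. Qed.

Lemma navier_is_linear nu k : linear (@navier K d nu k).
Proof.
move=> c u v; rewrite !navierE !linearP /= (scalerDr c (helmholtz k u)).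
by rewrite scalerDr !scalerA [c * _]mulrC addrACA.
Qed.

HB.instance Definition _ nu k :=
  GRing.isLinear.Build K (polyfield K d) (polyfield K d) _ (@navier K d nu k)
    (navier_is_linear nu k).

End Linearity.

(** * Commutation of constant-coefficient operators *)

Section Commutation.
Variables (K : fieldType) (d : nat).
Implicit Types (p : {mpoly K[d]}) (u : polyfield K d).

Lemma lap_mderiv i p : lap p^`M(i) = (lap p)^`M(i).
Proof.
rewrite /lap linear_sum; apply: eq_bigr => j _ /=.
by rewrite (mderiv_comm i) (mderiv_comm i).
Qed.

Lemma div_grad p : div (grad p) = lap p.
Proof. by apply: eq_bigr => j _; rewrite ffunE. Qed.

Lemma div_laplacian u : div (laplacian u) = lap (div u).
Proof.
rewrite [div u]/div linear_sum.
by apply: eq_bigr => i _; rewrite laplacianE /= lap_mderiv.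
Qed.

Lemma laplacian_grad p : laplacian (grad p) = grad (lap p).
Proof. by apply/ffunP => i; rewrite laplacianE !ffunE lap_mderiv. Qed.

Lemma div_helmholtz k u : div (helmholtz k u) = lap (div u) + k ^+ 2 *: div u.
Proof. by rewrite /helmholtz linearD linearZ /= div_laplacian. Qed.

Lemma helmholtz_grad_div k u :
  helmholtz k (grad (div u)) = grad (div (helmholtz k u)).
Proof.
by rewrite div_helmholtz /helmholtz laplacian_grad linearD linearZ.
Qed.

Lemma laplacian_helmholtz k u :
  laplacian (helmholtz k u) = helmholtz k (laplacian u).
Proof. by rewrite /helmholtz linearD linearZ. Qed.

Lemma helmholtzC k l u :
  helmholtz k (helmholtz l u) = helmholtz l (helmholtz k u).
Proof.
rewrite [helmholtz l u]/helmholtz linearD linearZ /=.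
by rewrite -laplacian_helmholtz.
Qed.

End Commutation.

(** * Degree bounds and solvability *)

Section Solvability.
Variables (K : fieldType) (d : nat).
Implicit Types (p : {mpoly K[d]}) (u : polyfield K d).

(** Each monomial either is killed by the derivative or loses one degree; the
    predecessor is truncated, which covers the zero polynomial. *)
Lemma msize_mderiv i p : (msize p^`M(i) <= (msize p).-1)%N.
Proof.
apply: leq_trans (msize_sum _ _ _) _.
apply/bigmax_leqP_seq => m mp _; have mlt := msize_mdeg_lt mp.
have [m0|m_gt0] := posnP (m i); first by rewrite m0 mul0r scale0r msize0.
apply: leq_trans (msizeZ_le _ _) _; rewrite msizeX.
have mK : (m - U_(i) + U_(i))%MM = m by rewrite submK // lep1mP -lt0n.
have -> : (mdeg (m - U_(i))).+1 = mdeg m by rewrite -{2}mK mdegD mdeg1 addn1.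
by rewrite -ltnS (ltn_predK mlt).
Qed.

Lemma msize_sum_le n (F : 'I_d -> {mpoly K[d]}) :
  (forall i, (msize (F i) <= n)%N) -> (msize (\sum_i F i) <= n)%N.
Proof.
by move=> Fn; apply: leq_trans (msize_sum _ _ _) _; apply/bigmax_leqP.
Qed.

Lemma msize_div N u : in_PN N u -> (msize (div u) <= N)%N.
Proof.
move=> uN; apply: msize_sum_le => i; apply: leq_trans (msize_mderiv _ _) _.
by rewrite -subn1 leq_subLR.
Qed.

Lemma msize_lap p : (msize (lap p) <= (msize p).-1)%N.
Proof.
apply: msize_sum_le => i.
exact: leq_trans (leq_trans (msize_mderiv _ _) (leq_pred _)) (msize_mderiv _ _).
Qed.

(** If [p] were nonzero, the two sides of [c *: p = - (a *: lap p)] would have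
    different degrees, as the Laplacian lowers the degree.  The coefficient [a] is
    free because the divergence of the Navier operator is
    [(1 + (1 - 2 nu)^-1) Delta + k^2] applied to the divergence. *)
Lemma lap_shift_inj (a c : K) p : c != 0 -> a *: lap p + c *: p = 0 -> p = 0.
Proof.
move=> c0 /eqP; rewrite addr_eq0 => /eqP h.
apply/eqP; rewrite -(mmeasure_poly_eq0 mdeg) -leqn0 leqNgt.
apply/negP => p_gt0; suff: (msize p < msize p)%N by rewrite ltnn.
rewrite -[X in (_ < X)%N](ltn_predK p_gt0) ltnS -[X in (X <= _)%N](msizeZ _ c0).
rewrite -mmeasureN -h; apply: leq_trans (msizeZ_le _ _) (msize_lap p).
Qed.

Lemma helmholtz_inj k u : k != 0 -> helmholtz k u = 0 -> u = 0.
Proof.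
move=> k0 /ffunP h; apply/ffunP => i; rewrite ffunE.
have k20 : k ^+ 2 != 0 by rewrite expf_neq0.
by apply: (lap_shift_inj (a := 1) k20); rewrite scale1r -helmholtzE h ffunE.
Qed.

(** Induction on the degree: the equation for [laplacian u], of smaller degree,
    has a solution [r], and then [k^-2 (u - r)] solves the one for [u], since
    [helmholtz k u = laplacian u + k^2 u]. *)
Lemma helmholtz_exists (k : K) (n : nat) u : k != 0 ->
  (forall i, (msize (u i) <= n)%N) ->
  exists2 v : polyfield K d, (forall i, (msize (v i) <= n)%N) & helmholtz k v = u.
Proof.
move=> k0; have k20 : k ^+ 2 != 0 by rewrite expf_neq0.
elim: n u => [|n IHn] u u_n.
  exists u => //; suff -> : u = 0 by rewrite linear0.
  apply/ffunP => i; rewrite ffunE; apply/eqP.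
  by rewrite -(mmeasure_poly_eq0 mdeg) -leqn0.
have [|r r_n rE] := IHn (laplacian u).
  move=> i; rewrite laplacianE; apply: leq_trans (msize_lap _) _.
  by rewrite -subn1 leq_subLR.
exists ((k ^+ 2)^-1 *: (u - r)).
  move=> i; rewrite !ffunE; apply: leq_trans (msizeZ_le _ _) _.
  apply: leq_trans (mmeasureD_le _ _ _) _.
  by rewrite mmeasureN geq_max u_n leqW.
rewrite linearZ linearB /= rE /helmholtz addrC addKr.
by rewrite scalerA mulVf // scale1r.
Qed.

Lemma helmholtz_unique_solution (k : K) (N : nat) u : k != 0 -> in_PN N u ->
  exists v : polyfield K d, unique_poly_solution N (helmholtz k) u v.
Proof.
move=> k0 uN; have [v vN vE] := helmholtz_exists k0 uN.
exists v; split=> // w wE; apply/eqP; rewrite -subr_eq0; apply/eqP.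
by apply: (helmholtz_inj k0); rewrite linearB /= wE vE subrr.
Qed.

(** Taking the divergence decouples the system: [div u] satisfies a scalar
    equation, and once it vanishes only the Helmholtz operator is left. *)
Lemma navier_inj nu k u : k != 0 -> navier nu k u = 0 -> u = 0.
Proof.
move=> k0; rewrite navierE => uE.
have k20 : k ^+ 2 != 0 by rewrite expf_neq0.
suff div0 : div u = 0.
  by apply: (helmholtz_inj k0); move: uE; rewrite div0 linear0 scaler0 addr0.
apply: (lap_shift_inj (a := 1 + (1 - 2 * nu)^-1) k20).
have := congr1 (@div K d) uE.
rewrite linearD linearZ linear0 /= div_helmholtz div_grad.
by rewrite scalerDl scale1r addrAC.
Qed.

Lemma in_PN_potential a k (N : nat) u :
  in_PN N u -> in_PN N (a *: helmholtz k u - grad (div u)).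
Proof.
move=> uN i; rewrite !ffunE; apply: leq_trans (mmeasureD_le _ _ _) _.
rewrite geq_max mmeasureN; apply/andP; split.
  apply: leq_trans (msizeZ_le _ _) _.
  apply: leq_trans (mmeasureD_le _ _ _) _; rewrite geq_max.
  rewrite (leq_trans (msizeZ_le _ _)) // andbT.
  exact: leq_trans (leq_trans (msize_lap _) (leq_pred _)) _.
apply: leq_trans (leq_trans (msize_mderiv _ _) (leq_pred _)) _.
by apply/leqW/msize_div.
Qed.

End Solvability.

(** * The Navier operator on the potential representation *)

Section Potential.
Variables (K : fieldType) (d : nat) (nu k1 k2 : K).
Hypothesis nu_half : 1 - 2 * nu != 0.
Hypothesis wave_numbers : 2 * (1 - nu) * k1 ^+ 2 = (1 - 2 * nu) * k2 ^+ 2.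

(** The relation between the wave numbers makes the longitudinal Helmholtz
    operator of [g], corrected by [- grad (div g)], have a divergence driven by
    the transversal wave number only. *)
Lemma div_potential (g : polyfield K d) :
  div (2 * (1 - nu) *: helmholtz k1 g - grad (div g))
    = (1 - 2 * nu) *: div (helmholtz k2 g).
Proof.
rewrite linearB linearZ /= !div_helmholtz div_grad !scalerDr !scalerA.
rewrite wave_numbers addrAC; congr (_ + _).
by rewrite -[X in _ - X]scale1r -scalerBl; congr (_ *: _); ring.
Qed.

(** The elastic coupling term cancels what [- grad (div g)] contributes, and
    the Navier operator factors into the two Helmholtz operators. *)
Lemma navier_potential (g : polyfield K d) :
  navier nu k2 (2 * (1 - nu) *: helmholtz k1 g - grad (div g))
    = 2 * (1 - nu) *: helmholtz k1 (helmholtz k2 g).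
Proof.
rewrite navierE div_potential linearZ /= scalerA mulVf // scale1r.
by rewrite linearB linearZ /= helmholtz_grad_div helmholtzC subrK.
Qed.

End Potential.

(** * The time-harmonic Navier equation *)

Theorem mainTheorem8 (R : rcfType) (K : fieldType) (iota : {rmorphism R -> K})
    (d : nat) (hd : d = 2%N \/ d = 3%N)
    (rho mu nu omega : R)
    (hrho : 0 < rho) (hmu : 0 < mu) (hnu0 : 0 < nu) (hnu1 : nu < 2^-1)
    (homega : 0 < omega)
    (N : nat) (f : polyfield K d) (hf : in_PN N f) :
  let c1 := Num.sqrt (2 * mu * (1 - nu) / (rho * (1 - 2 * nu))) in
  let c2 := Num.sqrt (mu / rho) in
  let k1 := omega / c1 in
  let k2 := omega / c2 in
  let rhs := iota (2 * (1 - nu))^-1 *: f in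
  (exists q : polyfield K d,
      unique_poly_solution N (helmholtz (iota k1)) rhs q) /\
  (forall q : polyfield K d,
      in_PN N q -> helmholtz (iota k1) q = rhs ->
      (exists g : polyfield K d,
          unique_poly_solution N (helmholtz (iota k2)) q g) /\
      (forall g : polyfield K d,
          in_PN N g -> helmholtz (iota k2) g = q ->
          unique_poly_solution N (navier (iota nu) (iota k2)) f
            (iota (2 * (1 - nu)) *: helmholtz (iota k1) g - grad (div g)))).
Proof.
move=> c1 c2 k1 k2 rhs.
have nu1 : 0 < 1 - nu by lra.
have nu2 : 0 < 1 - 2 * nu by lra.
have c1_arg : 0 < 2 * mu * (1 - nu) / (rho * (1 - 2 * nu)).
  by rewrite divr_gt0 // !mulr_gt0.
have c2_arg : 0 < mu / rho by rewrite divr_gt0.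
have k1_neq0 : k1 != 0 by rewrite gt_eqF // divr_gt0 // sqrtr_gt0.
have k2_neq0 : k2 != 0 by rewrite gt_eqF // divr_gt0 // sqrtr_gt0.
have wave : 2 * (1 - nu) * k1 ^+ 2 = (1 - 2 * nu) * k2 ^+ 2.
  rewrite /k1 /k2 !expr_div_n !sqr_sqrtr ?ltW //.
  by field; rewrite !gt_eqF.
have ik1 : iota k1 != 0 by rewrite fmorph_eq0.
have ik2 : iota k2 != 0 by rewrite fmorph_eq0.
have iE1 : iota (2 * (1 - nu)) = 2 * (1 - iota nu).
  by rewrite rmorphM rmorphB rmorph1 rmorph_nat.
have iE2 : iota (1 - 2 * nu) = 1 - 2 * iota nu.
  by rewrite rmorphB rmorphM rmorph1 rmorph_nat.
have inu2 : 1 - 2 * iota nu != 0 by rewrite -iE2 fmorph_eq0 gt_eqF.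
have iwave : 2 * (1 - iota nu) * iota k1 ^+ 2
             = (1 - 2 * iota nu) * iota k2 ^+ 2.
  by rewrite -iE1 -iE2 -!rmorphXn -!rmorphM wave.
have inu1 : iota (2 * (1 - nu)) != 0 by rewrite fmorph_eq0 gt_eqF // mulr_gt0.
split.
  apply: helmholtz_unique_solution => // i; rewrite ffunE.
  exact: leq_trans (msizeZ_le _ _) (hf i).
move=> q qN qE; split; first exact: helmholtz_unique_solution.
move=> g gN gE.
have uE : navier (iota nu) (iota k2)
    (iota (2 * (1 - nu)) *: helmholtz (iota k1) g - grad (div g)) = f.
  rewrite iE1 navier_potential // gE qE -iE1 /rhs scalerA.
  by rewrite fmorphV mulfV // scale1r.
split=> //; first exact: in_PN_potential.
move=> v vE; apply/eqP; rewrite -subr_eq0; apply/eqP.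
by apply: (navier_inj (nu := iota nu) ik2); rewrite linearB /= vE uE subrr.
Qed.
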